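(* (In $\mathsf{ZFC}$.) There is an infinite Hausdorff countably compact topological Boolean group without non-trivial convergent sequences.
   Context: An infinite topological space $X$ is countably compact if every infinite subset of $X$ has an accumulation point in $X$. A Boolean group is a group in which each element is its own inverse. A convergent sequence is non-trivial if it is not eventually constant. A topological group is without non-trivial convergent sequences if every convergent sequence in it is eventually constant. *)

(* Defs.v *)
From HB Require Import structures.
From mathcomp Require Import all_boot.
From mathcomp Require Import all_classical all_reals all_analysis.

Set Implicit Arguments.
Unset Strict Implicit.
Unset Printing Implicit Defensive.

Local Open Scope classical_set_scope.
Local Open Scope group_scope.

(* The library only has topological groups that are commutative and written
   additively (topologicalZmodType). *)
HB.mixin Record isTopologicalGroup G of Topological G & Group G := {
  mulg_continuous : continuous (fun x : G * G => x.1 * x.2) ;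
  invg_continuous : continuous (fun x : G => x^-1)
}.

#[short(type="topologicalGroupType")]
HB.structure Definition TopologicalGroup :=
  {G of Topological G & Group G & isTopologicalGroup G}.

Definition boolean_group (G : groupType) := forall x : G, x^-1 = x.

(* This is the right notion of countable compactness for infinite Hausdorff
   (or merely T1) spaces; it holds vacuously for finite ones. *)
Definition countably_compact (T : topologicalType) :=
  forall A : set T, infinite_set A -> limit_point A !=set0.

Definition eventually_constant (T : Type) (u : nat -> T) :=
  exists c : T, \forall n \near \oo, u n = c.

Definition no_nontrivial_cvg_seq (T : topologicalType) :=
  forall (u : nat -> T) (l : T), u @ \oo --> l -> eventually_constant u.

(* Main.v *)
Require Import Defs.
From HB Require Import structures.
From mathcomp Require Import all_boot.
From mathcomp Require Import all_classical all_reals all_analysis.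
From mathcomp Require Import zify.

(** The group is generated, as a Boolean group, by a set X such that every
    sequence f of linearly independent vectors (finite sums of generators) has
    two generators x attached to it, each coming with an ultrafilter U_x on the
    integers. Its topology is the weakest one that makes continuous the
    homomorphisms Phi to Z/2 with Phi x = U_x-lim Phi (f n) for every such x.
    By design each x attached to f is then a limit point of f. Since every
    infinite subset of a Boolean group contains an injective independent
    sequence, every infinite set has two limit points
    ([two_limit_points]); this gives countable compactness, and, in a Hausdorff
    space, it forbids nontrivial convergent sequences
    ([two_limit_points_no_cvg_seq]).

    What must be proved is that there are enough homomorphisms Phi: every
    nonzero vector l has one with Phi l = 1 ([limit_preserving_separation]).
    This needs a good choice of the ultrafilters. The integers are cut into
    consecutive finite blocks, block m being longer than m times budget m, where
    budget m is exponential in the least element of the block. The generators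
    are coded by an almost disjoint family of sets of integers, and U_x contains
    every set that, for some c, misses at most c * budget m elements of each
    block m with m >= c in the set coding x. Almost disjointness lets countably
    many generators share out the blocks, up to finitely many blocks each.

    Let D be a countable set of generators, containing those of l, and
    containing with x the generators of the vectors f n, for f the sequence of
    x. Run through the integers n. If n is in a block owned by x, the vector f n
    is in general not in the span of the finite set made of l, the first few
    elements of D and the vectors met before n: a pigeonhole argument on the
    2 ^ k combinations of these k vectors shows that the exceptions in a block
    number at most its budget ([independent_redundant]). At each of the other n,
    add to the functional built so far a functional that vanishes on that finite
    set, so as to obtain Phi (f n) = Phi x ([approx_kept]). The value at each
    element of D changes only finitely often, so a limit functional exists on D,
    and it satisfies the equation of x on a set of U_x. Outside D, the limit
    equations themselves define Phi by well-founded recursion ([extend]).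

    For the recursion, X is a type of well-founded trees, a tree carrying the
    sequence it is attached to, whose generators are its immediate subtrees. *)

Set Implicit Arguments.
Unset Strict Implicit.
Unset Printing Implicit Defensive.

Local Open Scope classical_set_scope.

(** * Generators *)

(** A generator [Lim b s g] is attached to the sequence whose n-th vector is the
    formal sum of the [g n j] for [j < s n]; the flag [b] makes two generators
    for each sequence. The leaves start the recursion: [terms] gives them the null
    sequence, which is not independent, so that no limit equation binds them. *)
Inductive tree : Type :=
| Leaf of nat
| Lim of bool & (nat -> nat) & (nat -> nat -> tree).

HB.instance Definition _ := gen_eqMixin tree.
HB.instance Definition _ := gen_choiceMixin tree.

Definition terms (t : tree) (n : nat) : seq tree :=
  if t is Lim _ s g then mkseq (g n) (s n) else [::].

Definition lim_of (b : bool) (f : nat -> seq tree) : tree :=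
  Lim b (fun n => size (f n)) (fun n => nth (Leaf 0) (f n)).

Lemma terms_lim_of b f : terms (lim_of b f) = f.
Proof. by apply/funext => n; rewrite /= mkseq_nth. Qed.

(** A tree is determined by the data found at the end of each finite path, so
    there are at most continuum many trees. *)
Fixpoint label (t : tree) (p : seq (nat * nat)) (n : nat) : nat + bool * nat :=
  match t, p with
  | Leaf k, _ => inl k
  | Lim b s g, [::] => inr (b, s n)
  | Lim b s g, (i, j) :: p' => label (g i j) p' n
  end.

Lemma label_inj : injective label.
Proof.
elim=> [k|b s g IH] [k'|b' s' g'] E.
- by have [->] := congr1 (fun c => c [::] 0) E.
- by have := congr1 (fun c => c [::] 0) E.
- by have := congr1 (fun c => c [::] 0) E.
have [Eb _] := congr1 (fun c => c [::] 0) E.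
have Es : s = s' by apply/funext => n; have [] := congr1 (fun c => c [::] n) E.
have Eg : g = g'.
  apply/funext => i; apply/funext => j; apply: IH.
  apply/funext => p; apply/funext => n.
  exact: (congr1 (fun c => c ((i, j) :: p) n) E).
by rewrite Eb Es Eg.
Qed.

Definition stream (t : tree) (i : nat) : nat :=
  if unpickle i is Some (p, n) then pickle (label t p n) else 0.

Lemma stream_inj : injective stream.
Proof.
move=> t t' E; apply: label_inj; apply/funext => p; apply/funext => n.
have := congr1 (fun c => c (pickle (p, n))) E.
by rewrite /stream pickleK => /(pcan_inj pickleK).
Qed.

(** Two distinct points of the Baire space have finitely many common initial
    segments, whence an almost disjoint family indexed by the trees. *)
Definition branch (t : tree) : set nat := range (fun l => pickle (mkseq (stream t) l)).

Lemma branch_unbounded t c : exists2 m, c <= m & branch t m.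
Proof.
apply: contrapT => N.
have lt_c l : pickle (mkseq (stream t) l) < c.
  by rewrite ltnNge; apply/negP => le_c; apply: N; eexists; last by exists l.
have inj : injective (fun l : 'I_c.+1 => Ordinal (lt_c l)).
  move=> l l' /(congr1 val) /= /(pcan_inj pickleK) /(congr1 size).
  by rewrite !size_mkseq => /val_inj.
by have := leq_card _ inj; rewrite !card_ord ltnn.
Qed.

Lemma branch_almost_disjoint t t' : t <> t' ->
  exists M, forall m, branch t m -> branch t' m -> m < M.
Proof.
move=> neq.
have [i Ni] : exists i, stream t i <> stream t' i.
  by apply/existsNP => E; apply/neq/stream_inj/funext.
exists (\max_(l < i.+1) (pickle (mkseq (stream t) l))).+1.
move=> m [l _ <-] [l' _] /(pcan_inj pickleK) E.
have El : l = l' by rewrite -(size_mkseq (stream t) l) -E size_mkseq.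
rewrite -{}El in E.
have le_li : l < i.+1.
  rewrite ltnS leqNgt; apply/negP => lt_il; apply: Ni.
  by rewrite -(nth_mkseq 0 (stream t) lt_il) -E nth_mkseq.
by rewrite ltnS (leq_bigmax (Ordinal le_li)).
Qed.

(** * Vectors over the field with two elements *)

(** A list of trees stands for the sum of its entries in the vector space over
    Z/2 with basis the trees; [ev chi] is the linear functional that has the
    values [chi] on this basis. Since functionals separate vectors, two lists
    stand for the same vector when all functionals agree on them. *)
Definition ev (chi : tree -> bool) (l : seq tree) : bool :=
  \big[addb/false]_(t <- l) chi t.

Lemma ev_nil chi : ev chi [::] = false.
Proof. by rewrite /ev big_nil. Qed.

Lemma ev_seq1 chi t : ev chi [:: t] = chi t.
Proof. by rewrite /ev big_seq1. Qed.

Lemma ev_cat chi l l' : ev chi (l ++ l') = ev chi l (+) ev chi l'.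
Proof. by rewrite /ev big_cat. Qed.

Lemma ev_add chi psi l :
  ev (fun t => chi t (+) psi t) l = ev chi l (+) ev psi l.
Proof. by rewrite /ev big_split. Qed.

Lemma eq_in_ev chi psi l : {in l, chi =1 psi} -> ev chi l = ev psi l.
Proof. by move=> E; apply: eq_big_seq. Qed.

Definition span (W : seq (seq tree)) (v : seq tree) : Prop :=
  exists2 b : bitseq, size b = size W &
    forall chi, ev chi v = ev chi (flatten (mask b W)).

(** Induction on [W]: a functional that kills the tail of [W] and takes the value
    1 at [v], another one that kills this tail and takes the value 1 at
    [v + w], or their sum, kills the head [w] as well and takes the value 1 at
    [v]. *)
Lemma separation W v : ~ span W v ->
  exists2 psi, {in W, forall w, ev psi w = false} & ev psi v.
Proof.
elim: W v => [|w W IH] v Nspan.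
  have [psi Hpsi] : exists psi, ev psi v.
    apply: contrapT => /forallNP N; apply: Nspan; exists [::] => // chi /=.
    by rewrite ev_nil; apply/negP/N.
  by exists psi.
have N1 : ~ span W v.
  by case=> b sz E; apply: Nspan; exists (false :: b); rewrite //= sz.
have N2 : ~ span W (v ++ w).
  case=> b sz E; apply: Nspan; exists (true :: b); rewrite /= ?sz // => chi.
  by rewrite ev_cat -E ev_cat addbCA addbb addbF.
have [psi kill Hv] := IH _ N1; have [psi' kill' Hvw] := IH _ N2.
have [Hw|/negbTE Hw] := boolP (ev psi w); last first.
  by exists psi => // u; rewrite inE => /predU1P[->//|]; exact: kill.
rewrite ev_cat in Hvw.
have [Hw'|/negbTE Hw'] := boolP (ev psi' w); last first.
  exists psi'; last by rewrite Hw' addbF in Hvw.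
  by move=> u; rewrite inE => /predU1P[->//|]; exact: kill'.
exists (fun t => psi t (+) psi' t); last first.
  by rewrite ev_add Hv; move: Hvw; rewrite Hw'; case: ev.
move=> u; rewrite inE ev_add => /predU1P[->|uW]; first by rewrite Hw Hw'.
by rewrite kill // kill'.
Qed.

(** Linear independence: a relation would express its vector of highest index
    through the others. Repetitions in [s] are harmless, as they cancel. *)
Definition independent (f : nat -> seq tree) : Prop :=
  forall n (s : seq nat), all (fun i => i < n) s ->
    exists chi, ev chi (f n) <> ev chi (flatten (map f s)).

(** If [f n] is the sum of a combination of [X] and of earlier terms of [f], and
    [f n'], with n < n', likewise with the same combination of [X], then [f n'] is
    a sum of earlier terms of [f], against independence. Hence distinct
    redundant indices use distinct combinations of [X]. *)
Lemma independent_redundant (f : nat -> seq tree) (X : seq (seq tree)) a k :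
  independent f ->
  count (fun n => `[< span (X ++ map f (iota a (n - a))) (f n) >]) (iota a k)
    <= 2 ^ size X.
Proof.
move=> indf; set bad := fun n => _; rewrite -size_filter.
have /choice[bt Hbt] n : exists t : (size X).-tuple bool, bad n ->
    exists2 s : seq nat, all (fun i => i < n) s & forall chi,
      ev chi (f n) = ev chi (flatten (mask t X)) (+) ev chi (flatten (map f s)).
  have [/asboolP [b sz E]|] := boolP (bad n); last by exists [tuple of nseq _ true].
  have szb : size (take (size X) b) == size X.
    by rewrite size_takel // sz size_cat leq_addr.
  exists (Tuple szb) => _.
  exists (mask (drop (size X) b) (iota a (n - a))).
    apply/allP => i /mem_mask; rewrite mem_iota; lia.
  move=> chi; rewrite E -{1}(cat_take_drop (size X) b) mask_cat ?(eqP szb) //.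
  by rewrite flatten_cat ev_cat map_mask.
have inj : {in [seq n <- iota a k | bad n] &, injective bt}.
  have lt_inj n n' : n < n' -> bad n -> bad n' -> bt n = bt n' -> False.
    move=> lt_nn' /Hbt[s lts E] /Hbt[s' lts' E'] Ebt.
    have [] := indf n' (n :: s ++ s').
      rewrite /= lt_nn' all_cat lts' andbT.
      by apply: sub_all lts => i /= lti; exact: ltn_trans lti lt_nn'.
    move=> chi; apply; rewrite E' -Ebt /= map_cat flatten_cat !ev_cat E.
    by case: ev; case: ev; case: ev.
  move=> n n'; rewrite !mem_filter => /andP[bn _] /andP[bn' _] Ebt.
  by case: (ltngtP n n') => // lt_nn';
    [case: (lt_inj n n')|case: (lt_inj n' n)].
rewrite -(size_map bt).
have u : uniq (map bt [seq n <- iota a k | bad n]).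
  by rewrite map_inj_in_uniq // filter_uniq // iota_uniq.
by rewrite -(card_uniqP u) (leq_trans (max_card _)) // card_tuple card_bool.
Qed.

(** * Blocks and ultrafilters *)

(** [budget m] is the number of combinations of the m + 3 + start m vectors
    that have to be avoided when block m is treated: the vector to be separated
    from 0, the first m + 2 generators in an enumeration, and one vector for
    each integer before the block. *)
Fixpoint start (m : nat) : nat :=
  if m is k.+1 then start k + (k * 2 ^ (k + 3 + start k)).+1 else 0.

Definition budget (m : nat) : nat := 2 ^ (m + 3 + start m).

Definition block (m : nat) : seq nat := iota (start m) (m * budget m).+1.

Lemma startS m : start m.+1 = start m + (m * budget m).+1.
Proof. by []. Qed.

Lemma leq_start : {homo start : m n / m <= n}.
Proof.
apply: homo_leq => [//|? ? ?|m]; first exact: leq_trans.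
by rewrite startS leq_addr.
Qed.

Fixpoint column (n : nat) : nat :=
  if n is k.+1 then
    if n < start (column k).+1 then column k else (column k).+1
  else 0.

Lemma column_bounds n : start (column n) <= n < start (column n).+1.
Proof.
elim: n => [|n /andP[le lt]]; first by [].
have E : column n.+1 = if n.+1 < start (column n).+1 then column n else (column n).+1 by [].
rewrite {}E; case: ifPn => [-> |]; first by rewrite (leq_trans le).
by rewrite -leqNgt => ge; rewrite ge startS addnS ltnS (leq_trans lt) ?leq_addr.
Qed.

Lemma leq_column m n : start m <= n -> m <= column n.
Proof.
move=> le; rewrite leqNgt; apply/negP => /leq_start.
by have /andP[_] := column_bounds n; lia.
Qed.

Lemma column_mono : {homo column : m n / m <= n}.
Proof.
move=> m n le; apply: leq_column; apply: leq_trans le.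
by have /andP[] := column_bounds m.
Qed.

Lemma column_block m n : n \in block m -> column n = m.
Proof.
rewrite mem_iota -startS => /andP[le lt]; apply/eqP.
rewrite eqn_leq leq_column // andbT leqNgt; apply/negP => /leq_start.
by have /andP[+ _] := column_bounds n; lia.
Qed.

Definition missing (B : set nat) (m : nat) : nat :=
  count (fun n => ~~ `[< B n >]) (block m).

(** Allowing all multiples of the budget makes this a filter; it is proper
    because block m has more than m * budget m elements. *)
Definition spread (A : set nat) : set_system nat :=
  [set B | exists c, forall m, c <= m -> A m -> missing B m <= c * budget m].

Lemma spread_proper A : (forall c, exists2 m, c <= m & A m) -> ProperFilter (spread A).
Proof.
move=> unbA; apply: Build_ProperFilter_ex.
  move=> B [c Hc]; have [m le_cm Am] := unbA c.
  apply: contrapT => N.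
  have E : missing B m = size (block m).
    apply/eqP; rewrite -all_count; apply/allP => n _.
    by apply/asboolP => Bn; apply: N; exists n.
  have := Hc _ le_cm Am; rewrite E size_iota.
  have : c * budget m <= m * budget m by rewrite leq_mul2r le_cm orbT.
  lia.
split.
- exists 0 => m _ _; rewrite /missing (eq_count (a2 := pred0)) ?count_pred0 //.
  by move=> n; apply/negbTE; rewrite negbK; apply/asboolP.
- move=> B C [c Hc] [d Hd]; exists (c + d) => m le Am.
  have [le_c le_d] : c <= m /\ d <= m by lia.
  rewrite mulnDl (leq_trans _ (leq_add (Hc m le_c Am) (Hd m le_d Am))) //.
  rewrite /missing -count_predUI (leq_trans _ (leq_addr _ _)) //.
  by apply: sub_count => n /=; rewrite -negb_and asbool_and.
- move=> B C sBC [c Hc]; exists c => m le Am; apply: leq_trans (Hc m le Am).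
  by apply: sub_count => n /=; apply: contra => /asboolP Bn; apply/asboolP/sBC.
Qed.

Lemma spread_ultra t : exists F, UltraFilter F /\ spread (branch t) `<=` F.
Proof. exact/ultraFilterLemma/spread_proper/branch_unbounded. Qed.

Definition ultra (t : tree) : set_system nat := projT1 (cid (spread_ultra t)).

#[global] Instance ultra_ultra t : UltraFilter (ultra t).
Proof. by rewrite /ultra; case: cid => F []. Qed.

Lemma spread_sub_ultra t : spread (branch t) `<=` ultra t.
Proof. by rewrite /ultra; case: cid => F []. Qed.

(** The complement of a point misses one element of one block, and a budget is
    at least 1: the ultrafilters are free. *)
Lemma ultra_neq t n : ultra t (fun k => k <> n).
Proof.
apply: spread_sub_ultra; exists 1 => m _ _; rewrite mul1n.
apply: (@leq_trans 1); last by rewrite /budget expn_gt0.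
apply: (@leq_trans (count_mem n (block m))).
  by apply: sub_count => k /= /asboolP /contrapT ->.
by rewrite count_uniq_mem ?iota_uniq // leq_b1.
Qed.

(** * Functionals that respect the limits *)

(** Along an ultrafilter, a sequence of booleans converges to true if it is true
    on a set of the ultrafilter, and to false otherwise. *)
Definition limit_preserving (Phi : tree -> bool) : Prop :=
  forall t, independent (terms t) ->
    Phi t = `[< ultra t [set n | ev Phi (terms t n)] >].

(** The functional is first built on a countable set of generators, the range of
    [e], which contains with a tree its immediate subtrees. *)
Section CountableDomain.

Variables (e : nat -> tree) (l0 : seq tree) (chi0 : tree -> bool).
Hypothesis e_closed : forall t n, range e t -> {in terms t n, forall u, range e u}.
Hypothesis chi0_l0 : ev chi0 l0.

(** Block m goes to the first of e 0, ..., e m whose coding set contains m. If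
    there is none, [find] returns m + 1 and the block goes to e (m + 1). In both
    cases the owner is among e 0, ..., e (m + 1). *)
Definition owner (m : nat) : tree :=
  e (find (fun k => `[< branch (e k) m >]) (iota 0 m.+1)).

Definition assigned (n : nat) : seq tree := terms (owner (column n)) n.

(** The vectors at which the value of the functional is not allowed to change
    any more at stage [n]. *)
Definition protected (n : nat) : seq (seq tree) :=
  l0 :: [seq [:: e i] | i <- iota 0 (column n).+2] ++ map assigned (iota 0 n).

Lemma protected_e i n : i <= (column n).+1 -> [:: e i] \in protected n.
Proof.
move=> le_i; rewrite inE mem_cat (map_f (fun i => [:: e i])) ?orbT //.
by rewrite mem_iota.
Qed.

Lemma protected_owner m n : m <= n -> [:: owner (column m)] \in protected n.
Proof.
move=> le_mn; apply: protected_e; apply: leq_trans (find_size _ _) _.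
by rewrite size_iota ltnS column_mono.
Qed.

Lemma protected_assigned m n : m < n -> assigned m \in protected n.
Proof.
by move=> lt; rewrite inE mem_cat (map_f assigned) ?orbT // mem_iota.
Qed.

Definition kept (n : nat) : Prop := ~ span (protected n) (assigned n).

Lemma corrector_exists n : exists psi : tree -> bool,
  {in protected n, forall w, ev psi w = false} /\ (kept n -> ev psi (assigned n)).
Proof.
have [/separation[psi kill Hv]|Nk] := pselect (kept n); first by exists psi.
by exists xpred0; split=> // w _; rewrite /ev big1.
Qed.

Definition corrector (n : nat) : tree -> bool := projT1 (cid (corrector_exists n)).

Lemma corrector_protected n w : w \in protected n -> ev (corrector n) w = false.
Proof. by rewrite /corrector; case: cid => psi /= [+ _]; exact. Qed.

Lemma corrector_kept n : kept n -> ev (corrector n) (assigned n).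
Proof. by rewrite /corrector; case: cid => psi /= [_]; exact. Qed.

(** The [andb] factor tells whether the equation at [n] fails for [approx n]. The
    corrector vanishes at the owner of the block, which is protected, and, when
    [n] is kept, it takes the value 1 at the assigned vector; so adding it repairs
    the equation. *)
Fixpoint approx (n : nat) : tree -> bool :=
  if n is k.+1 then
    fun t => approx k t (+)
      ((ev (approx k) (assigned k) (+) approx k (owner (column k))) && corrector k t)
  else chi0.

Lemma ev_approxS n l : ev (approx n.+1) l = ev (approx n) l (+)
  ((ev (approx n) (assigned n) (+) approx n (owner (column n))) && ev (corrector n) l).
Proof.
rewrite /= ev_add; congr addb; case: (_ (+) _) => //=.
by rewrite /ev big1.
Qed.

Lemma approx_protected m n w :
  m <= n -> (forall k, m <= k < n -> w \in protected k) ->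
  ev (approx n) w = ev (approx m) w.
Proof.
move=> /subnK <-; elim: (n - m) => [//|d IH] Hw.
rewrite addSn ev_approxS corrector_protected ?andbF ?addbF; last by apply: Hw; lia.
by apply: IH => k le; apply: Hw; lia.
Qed.

Lemma approx_l0 n : ev (approx n) l0.
Proof. by rewrite (@approx_protected 0) // => k _; rewrite inE eqxx. Qed.

Lemma approx_e i m n : i <= (column m).+1 -> m <= n -> approx n (e i) = approx m (e i).
Proof.
move=> le_i le_mn; rewrite -!ev_seq1; apply: approx_protected => // k /andP[le_mk _].
by apply: protected_e; apply: leq_trans le_i _; rewrite ltnS column_mono.
Qed.

Lemma approx_owner m n : m <= n ->
  approx n (owner (column m)) = approx m (owner (column m)).
Proof.
move=> le_mn; rewrite -!ev_seq1; apply: approx_protected => // k /andP[le_mk _].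
exact: protected_owner.
Qed.

(** Repaired at stage [k], the equation survives: both of its sides are protected
    from then on. *)
Lemma approx_kept k n : kept k -> k < n ->
  ev (approx n) (assigned k) = approx n (owner (column k)).
Proof.
move=> kk lt_kn; rewrite (@approx_protected k.+1) //; last first.
  by move=> i /andP[lt_ki _]; exact: protected_assigned.
rewrite (approx_owner (ltnW lt_kn)) ev_approxS corrector_kept // andbT.
by rewrite addbA addbb.
Qed.

(** On the range of [e] the approximations are eventually constant, and this is
    their limit. *)
Definition approx_lim (t : tree) : bool := `[< \forall n \near \oo, approx n t >].

Lemma approx_limE t : range e t -> \forall n \near \oo, approx n t = approx_lim t.
Proof.
move=> [i _ <-].
(* From [start i] on, [e i] is among the first generators, which are protected. *)
have stab : \forall n \near \oo, approx n (e i) = approx (start i) (e i).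
  near=> n; apply: approx_e; last by near: n; exists (start i).
  by rewrite ltnW // ltnS leq_column.
suff -> : approx_lim (e i) = approx (start i) (e i) by [].
apply/asboolP/idP => [H|H].
  by have [n [Hn <-]] := @filter_ex _ _ _ _ (filterI H stab).
by apply: filterS stab => n ->.
Unshelve. all: by end_near. Qed.

Lemma ev_approx_limE l : {in l, forall t, range e t} ->
  \forall n \near \oo, ev (approx n) l = ev approx_lim l.
Proof.
elim: l => [|t l IH] Hl; first by near=> n; rewrite !ev_nil.
have IHl := IH (fun u ul => Hl u (@mem_behead _ (t :: l) _ ul)).
have Ht := approx_limE (Hl t (mem_head _ _)).
near=> n; rewrite /ev !big_cons; congr addb; first by near: n.
by near: n.
Unshelve. all: by end_near. Qed.

Lemma approx_lim_l0 : {in l0, forall t, range e t} -> ev approx_lim l0.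
Proof.
move=> /ev_approx_limE H.
by have [n <-] := @filter_ex _ _ _ _ H; exact: approx_l0.
Qed.

Lemma owner_range m : range e (owner m).
Proof. by eexists. Qed.

Lemma approx_lim_kept n : kept n ->
  ev approx_lim (assigned n) = approx_lim (owner (column n)).
Proof.
move=> kn; near \oo => N.
have <- : ev (approx N) (assigned n) = ev approx_lim (assigned n).
  by near: N; apply/ev_approx_limE/e_closed/owner_range.
have <- : approx N (owner (column n)) = approx_lim (owner (column n)).
  by near: N; apply/approx_limE/owner_range.
by apply: approx_kept => //; near: N; exists n.+1.
Unshelve. all: by end_near. Qed.

(** If t = e k, only the finitely many e i with i < k compete with t for a block,
    and each distinct one shares finitely many elements with the coding set
    of t. *)
Lemma owner_eventually t : range e t ->
  exists M, forall m, M <= m -> branch t m -> owner m = t.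
Proof.
move=> [k _ <-].
(* Beyond [M], a competitor of [t] whose coding set contains [m] equals [t]. *)
have [M HM] : exists M, forall i m, i < k -> M <= m -> branch (e i) m -> branch (e k) m ->
    e i = e k.
  elim: {1}k => [|j [M HM]]; first by exists 0.
  have [Ejk|/branch_almost_disjoint[N HN]] := pselect (e j = e k).
    exists M => i m; rewrite ltnS leq_eqVlt => /predU1P[-> //|]; exact: HM.
  exists (maxn M N) => i m; rewrite ltnS leq_eqVlt geq_max => /predU1P[->|lt] /andP[le1 le2].
    by move=> b1 b2; have := HN _ b1 b2; lia.
  exact: HM.
exists (maxn M k) => m; rewrite geq_max => /andP[leM lek] bkm.
rewrite /owner; set P := fun k => _; set i := find _ _.
have hasP : has P (iota 0 m.+1).
  by apply/hasP; exists k; [rewrite mem_iota|apply/asboolP].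
have lt_im : i < m.+1 by rewrite -[X in _ < X](size_iota 0) -has_find.
have Pi : branch (e i) m.
  by have := nth_find 0 hasP; rewrite nth_iota // => /asboolP.
have le_ik : i <= k.
  rewrite leqNgt; apply/negP => lt_ki; have := before_find 0 lt_ki.
  by rewrite nth_iota // /P => /asboolP.
by move: le_ik; rewrite leq_eqVlt => /predU1P[-> //|lt_ik]; exact: HM Pi bkm.
Qed.

(** This is what the ultrafilters are made for: in a block owned by [t], the
    indices that are not kept number at most the budget, so the kept ones form a
    set of the ultrafilter of [t]. *)
Lemma kept_ultra t : range e t -> independent (terms t) ->
  ultra t [set n | kept n /\ owner (column n) = t].
Proof.
move=> et indt; have [M HM] := owner_eventually et.
apply: spread_sub_ultra; exists (maxn M 1) => m; rewrite geq_max => /andP[le_Mm _] bm.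
apply: (@leq_trans (budget m)); last by rewrite leq_pmull // leq_max orbT.
have Em := HM m le_Mm bm.
(* The protected vectors that are common to all the indices of block [m]. *)
set X := l0 :: [seq [:: e i] | i <- iota 0 m.+2] ++ map assigned (iota 0 (start m)).
have szX : size X = m + 3 + start m.
  by rewrite /= size_cat !size_map !size_iota; lia.
rewrite /budget -szX /missing.
apply: leq_trans (independent_redundant X (start m) (m * budget m).+1 indt).
rewrite -!size_filter; apply/eq_leq; congr size.
apply: eq_in_filter => n nm; have En := column_block nm.
have eqt k : k \in block m -> assigned k = terms t k.
  by move=> /column_block Ek; rewrite /assigned Ek Em.
have Epr : protected n = X ++ map (terms t) (iota (start m) (n - start m)).
  rewrite /protected En /X cat_cons -catA; congr (_ :: (_ ++ _)).
  move: nm; rewrite mem_iota => /andP[le lt].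
  rewrite -{1}(subnKC le) iotaD map_cat; congr cat.
  apply/eq_in_map => i; rewrite mem_iota add0n => ii; apply: eqt.
  by rewrite mem_iota; lia.
rewrite -Epr -(eqt n nm); rewrite -asbool_neg; apply: asbool_equiv_eq; split => [N|H [+ _]].
  by apply: contrapT => Hk; apply: N; split; rewrite ?En.
exact.
Qed.

(** Outside the range of [e] the equation of [t] is used as a definition. The
    range of [e] is closed under immediate subtrees, so this does not disturb the
    equations inside it. *)
Fixpoint extend (t : tree) : bool :=
  if `[< range e t >] then approx_lim t
  else if t is Lim _ s g then
    `[< ultra t [set n | \big[addb/false]_(j <- iota 0 (s n)) extend (g n j)] >]
  else false.

Lemma extend_range t : range e t -> extend t = approx_lim t.
Proof. by move=> et; case: t et => [k|b s g] et /=; case: asboolP. Qed.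

Lemma extend_limit_preserving : limit_preserving extend.
Proof.
move=> t indt; have [et|Net] := pselect (range e t); last first.
  case: t indt Net => [k|b s g] indt Net.
    by have [chi] := indt 0 [::] isT.
  rewrite [LHS]/=; case: asboolP => // _; congr (`[< ultra _ _ >]).
  by apply/seteqP; split=> n /=; rewrite /ev /mkseq big_map.
rewrite (extend_range et).
have U : ultra t [set n | ev extend (terms t n) = approx_lim t].
  apply: filterS (kept_ultra et indt) => n /= [kn En].
  have := approx_lim_kept kn; rewrite /assigned En => <-.
  by apply: eq_in_ev => u ut; apply/extend_range/(e_closed et ut).
case: (approx_lim t) U => U; apply/esym/asboolP; first exact: U.
move=> U'; have [n [/= -> //]] := @filter_ex _ _ _ _ (filterI U U').
Qed.

End CountableDomain.

(** The subtrees of finitely many trees, listed by paths, form a countable set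
    closed under immediate subtrees. *)
Fixpoint subtree (t : tree) (p : seq (nat * nat)) : tree :=
  match t, p with
  | Lim _ _ g, (i, j) :: p' => subtree (g i j) p'
  | _, _ => t
  end.

Lemma subtree_terms t p n : {in terms (subtree t p) n, forall u,
  exists q, u = subtree t q}.
Proof.
elim: t p => [k|b s g IH] [|[i j] p] u //=.
  by move=> /mapP[j _ ->]; exists [:: (n, j)] => /=; case: (g n j).
by move=> /IH[q ->]; exists ((i, j) :: q).
Qed.

Lemma limit_preserving_separation l : (exists chi, ev chi l) ->
  exists2 Phi, limit_preserving Phi & ev Phi l.
Proof.
move=> [chi0 Hchi0].
pose e n := if unpickle n is Some (i, p) then subtree (nth (Leaf 0) l i) p else Leaf 0.
have re i p : range e (subtree (nth (Leaf 0) l i) p).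
  by exists (pickle (i, p)) => //; rewrite /e pickleK.
have e_closed t n : range e t -> {in terms t n, forall u, range e u}.
  move=> [k _ <-] u; rewrite /e; case: unpickle => [[i p]|] //.
  by move=> /subtree_terms[q ->].
have l_range : {in l, forall t, range e t}.
  move=> t tl; have := re (index t l) [::]; rewrite nth_index //.
  by case: (t).
exists (extend e l chi0); first exact: extend_limit_preserving.
rewrite (eq_in_ev (psi := approx_lim e l chi0)); first exact: approx_lim_l0.
by move=> t tl; apply/extend_range/l_range.
Qed.

(** * Sets with two limit points *)

Lemma hausdorff_nbhs_finiteC (T : topologicalType) (S : set T) (z : T) :
  hausdorff_space T -> finite_set S -> ~ S z -> nbhs z (~` S).
Proof.
move=> /hausdorff_accessible/accessible_finite_set_closed.1 closed_fin finS Sz.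
apply: open_nbhs_nbhs; split=> //.
by apply: closed_openC; exact: closed_fin.
Qed.

Lemma limit_point_cvg (T : topologicalType) (u : nat -> T) (l z : T) :
  hausdorff_space T -> u @ \oo --> l -> limit_point (range u) z -> z = l.
Proof.
move=> haus ul zlim; apply: (haus) => A B Az Bl.
have [N _ HN] := ul B Bl.
pose S := (u @` `I_N) `\ z.
have Sz : nbhs z (~` S).
  apply: hausdorff_nbhs_finiteC => //; last by case=> _; apply.
  by apply: finite_setD; apply/finite_image/finite_II.
have [y [/eqP neq [n _ En] [Ay NSy]]] := zlim _ (filterI Az Sz).
exists y; split=> //; rewrite -En; apply: HN => /=.
rewrite leqNgt; apply/negP => lt; apply: NSy; split => //.
by exists n.
Qed.

(** The range of a convergent sequence has at most one limit point, so it is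
    finite, and then the sequence is eventually equal to its limit. *)
Lemma two_limit_points_no_cvg_seq (T : topologicalType) :
  hausdorff_space T ->
  (forall A : set T, infinite_set A ->
    exists x y, [/\ x <> y, limit_point A x & limit_point A y]) ->
  no_nontrivial_cvg_seq T.
Proof.
move=> haus lim2 u l ul; have [fin|/lim2[x [y [neq xlim ylim]]]] :=
  pselect (finite_set (range u)); last first.
  by case: neq; rewrite (limit_point_cvg haus ul xlim) (limit_point_cvg haus ul ylim).
pose S := range u `\ l.
have Sl : nbhs l (~` S).
  apply: hausdorff_nbhs_finiteC => //; last by case=> _; apply.
  exact: finite_setD.
have uS : \forall n \near \oo, ~ S (u n) by exact: ul _ Sl.
exists l; apply: filterS uS => n NS.
by apply: contrapT => neq; apply: NS.
Qed.

(** * The group *)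

Definition limit_functional : Type := {Phi : tree -> bool | limit_preserving Phi}.

Definition eval_vec (l : seq tree) (Phi : limit_functional) : bool := ev (sval Phi) l.

(** The group generated by the trees, realized as a subgroup of a power of Z/2:
    vectors with the same values under all admissible functionals are
    identified. *)
Definition bool_group : Type :=
  {x : limit_functional -> bool | exists l, x = eval_vec l}.

Definition vec (l : seq tree) : bool_group :=
  exist _ (eval_vec l) (ex_intro _ l erefl).

Lemma vec_surj (x : bool_group) : exists l, vec l = x.
Proof. by case: x => x [l E]; exists l; apply: eq_exist. Qed.

Lemma bool_group_ext (x y : bool_group) : (forall Phi, sval x Phi = sval y Phi) -> x = y.
Proof. by case: x y => [x px] [y py] /= E; apply: eq_exist; apply/funext. Qed.

HB.instance Definition _ := gen_eqMixin bool_group.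
HB.instance Definition _ := gen_choiceMixin bool_group.

Lemma mul_subproof (x y : bool_group) :
  exists l, (fun Phi => sval x Phi (+) sval y Phi) = eval_vec l.
Proof.
have [[l <-] [l' <-]] := (vec_surj x, vec_surj y); exists (l ++ l').
by apply/funext => Phi; rewrite /eval_vec ev_cat.
Qed.

Definition mul_vec (x y : bool_group) : bool_group := exist _ _ (mul_subproof x y).

Lemma mul_vecA : associative mul_vec.
Proof. by move=> x y z; apply: bool_group_ext => Phi /=; rewrite addbA. Qed.

Lemma one_mul_vec : left_id (vec [::]) mul_vec.
Proof. by move=> x; apply: bool_group_ext => Phi /=; rewrite /eval_vec ev_nil. Qed.

Lemma mul_vec_one : right_id (vec [::]) mul_vec.
Proof.
by move=> x; apply: bool_group_ext => Phi /=; rewrite /eval_vec ev_nil addbF.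
Qed.

Lemma mul_vecxx : forall x, mul_vec x x = vec [::].
Proof. by move=> x; apply: bool_group_ext => Phi /=; rewrite addbb /eval_vec ev_nil. Qed.

HB.instance Definition _ := isGroup.Build bool_group
  mul_vecA one_mul_vec mul_vec_one mul_vecxx mul_vecxx.

(** The topology of pointwise convergence: these are its basic neighbourhoods. *)
Definition agree_on (F : seq limit_functional) (x : bool_group) : set bool_group :=
  [set y | all (fun Phi => sval y Phi == sval x Phi) F].

HB.instance Definition _ := hasNbhs.Build bool_group
  (fun x => filter_from setT (agree_on^~ x)).

Lemma nbhs_agree F (x : bool_group) : nbhs x (agree_on F x).
Proof. by exists F. Qed.

Lemma agree_on_refl F x : agree_on F x x.
Proof. by rewrite /agree_on /=; elim: F => //= Phi F ->; rewrite eqxx. Qed.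

Lemma agree_on_trans F x y z : agree_on F x y -> agree_on F y z -> agree_on F x z.
Proof.
rewrite /agree_on /=; elim: F => //= Phi F IH /andP[/eqP -> yx] /andP[-> zy].
exact: IH.
Qed.

Lemma agree_nbhs_filter (x : bool_group) : ProperFilter (nbhs x).
Proof.
apply: filter_from_proper; last by move=> F _; exists x; exact: agree_on_refl.
apply: filter_from_filter; first by exists [::].
move=> F F' _ _; exists (F ++ F') => // y; rewrite /agree_on /= all_cat.
by move=> /andP[].
Qed.

Lemma agree_nbhs_singleton (x : bool_group) (A : set bool_group) : nbhs x A -> A x.
Proof. by move=> [F _]; apply; exact: agree_on_refl. Qed.

Lemma agree_nbhs_nbhs (x : bool_group) (A : set bool_group) :
  nbhs x A -> nbhs x (nbhs^~ A).
Proof.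
move=> [F _ FA]; exists F => // y xy; exists F => // z yz.
exact/FA/(agree_on_trans xy).
Qed.

HB.instance Definition _ := Nbhs_isNbhsTopological.Build bool_group
  agree_nbhs_filter agree_nbhs_singleton agree_nbhs_nbhs.

Lemma mul_vec_continuous : continuous (fun x : bool_group * bool_group => (x.1 * x.2)%g).
Proof.
move=> [x y] A [F _ FA]; exists (agree_on F x, agree_on F y).
  by split; exact: nbhs_agree.
move=> [x' y'] [/= xx' yy']; apply: FA; move: xx' yy'; rewrite /agree_on /=.
elim: F => //= Phi F IH /andP[/eqP -> ?] /andP[/eqP -> ?].
by rewrite eqxx IH.
Qed.

Lemma inv_vec_continuous : continuous (fun x : bool_group => x^-1%g).
Proof. by move=> x A [F _ FA]; exists F. Qed.

HB.instance Definition _ := isTopologicalGroup.Build bool_group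
  mul_vec_continuous inv_vec_continuous.

Lemma bool_group_hausdorff : hausdorff_space bool_group.
Proof.
move=> x y xy; apply: bool_group_ext => Phi.
have [z [/andP[/eqP <- _] /andP[/eqP <- _]]] :=
  xy _ _ (nbhs_agree [:: Phi] x) (nbhs_agree [:: Phi] y).
by [].
Qed.

Lemma vec_cat l l' : vec (l ++ l') = (vec l * vec l')%g.
Proof. by apply: bool_group_ext => Phi; rewrite /= /eval_vec ev_cat. Qed.

Lemma bool_group_mulC : commutative (fun x y : bool_group => x * y)%g.
Proof. by move=> x y; apply: bool_group_ext => Phi; rewrite /= addbC. Qed.

Lemma bool_group_mulxx (x : bool_group) : (x * x)%g = 1%g.
Proof. exact: mul_vecxx. Qed.

(** Distinct generators form a nonzero sum, which some admissible functional
    detects. *)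
Lemma vec1_inj : injective (fun t => vec [:: t]).
Proof.
move=> t t' E; apply: contrapT => neq.
have [|Phi Phi_lim] := @limit_preserving_separation [:: t; t'].
  exists (pred1 t); rewrite /ev !big_cons big_nil /= eqxx addbF.
  by case: eqP => // /esym.
have Et := congr1 (fun x => sval x (exist _ Phi Phi_lim)) E.
by rewrite -cat1s ev_cat [ev _ _]Et addbb.
Qed.

Lemma bool_group_infinite : infinite_set [set: bool_group].
Proof.
move=> fin; apply: infinite_nat.
have inj : injective (fun n => vec [:: Leaf n]) by move=> m n /vec1_inj [].
rewrite -(eq_finite_set (inj_card_eq (A := setT) (in2W inj))).
exact: sub_finite_set fin.
Qed.

(** In a Boolean group finitely many elements generate a finite subgroup, so an
    infinite set has an element outside of it; iterating this choice gives the
    sequence. *)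
Lemma independent_sequence (A : set bool_group) : infinite_set A ->
  exists f : nat -> seq tree,
    [/\ independent f, injective (fun n => vec (f n)) & forall n, A (vec (f n))].
Proof.
move=> infA.
have /choice[pick Hpick] (H : seq bool_group) :
    exists l, A (vec l) /\ vec l \notin H.
  apply: contrapT => /forallNP N; apply: infA.
  apply: (@sub_finite_set _ _ [set` H]); last exact: finite_seq.
  move=> x Ax; have [l El] := vec_surj x; apply: contrapT => /negP xH.
  by apply: (N l); rewrite El.
(* [H n] lists the subgroup generated by the first [n] chosen elements. *)
pose fix H n := if n is k.+1 then H k ++ map (mul (vec (pick (H k)))) (H k)
  else [:: 1%g].
pose f n := pick (H n).
have mulH n i x : i < n -> x \in H n -> (vec (f i) * x)%g \in H n.
  elim: n i x => // n IH i x; rewrite ltnS leq_eqVlt /= !mem_cat.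
  move=> /predU1P[->|lt] /orP[xH|/mapP[y yH ->]]; apply/orP.
  - by right; apply: map_f.
  - by left; rewrite mulgA bool_group_mulxx mul1g.
  - by left; exact: IH.
  - by right; rewrite mulgA (bool_group_mulC _ (vec _)) -mulgA; apply/map_f/IH.
have spanH n s : all (fun i => i < n) s -> vec (flatten (map f s)) \in H n.
  elim: s => [_|i s IH /= /andP[lt /IH]] /=.
    by elim: (n) => [|k IH] /=; rewrite ?mem_cat ?IH // inE.
  by rewrite vec_cat; exact: mulH.
have fresh n s : all (fun i => i < n) s -> vec (f n) <> vec (flatten (map f s)).
  by move=> /spanH sH E; have [_] := Hpick (H n); rewrite -/(f n) E sH.
exists f; split=> [n s /fresh neq|m n E|n]; last by have [] := Hpick (H n).
- apply: contrapT => /forallNP N; apply: neq; apply: bool_group_ext => Phi /=.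
  exact: contrapT (N _).
- case: (ltngtP m n) => // lt.
  + by have /= := @fresh n [:: m]; rewrite lt cats0 E => /(_ isT).
  + by have /= := @fresh m [:: n]; rewrite lt cats0 E => /(_ isT).
Qed.

(** The limit equations of [lim_of b f] for finitely many functionals hold
    together on a set of its ultrafilter. *)
Lemma lim_of_agree (F : seq limit_functional) b f : independent f ->
  ultra (lim_of b f) [set n | agree_on F (vec [:: lim_of b f]) (vec (f n))].
Proof.
move=> indf; elim: F => [|[Phi Phi_lim] F IH]; first exact: filterE.
suff conv : ultra (lim_of b f) [set n | ev Phi (f n) = Phi (lim_of b f)].
  apply: filterS (filterI conv IH) => n [/= E]; rewrite /agree_on /= => ->.
  by rewrite /eval_vec /= ev_seq1 E eqxx.
have := Phi_lim (lim_of b f); rewrite terms_lim_of => /(_ indf) ->.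
have [Uf|Uf] := in_ultra_setVsetC [set n | ev Phi (f n)] (ultra_ultra (lim_of b f)).
  by rewrite asboolT.
rewrite asboolF; first by apply: filterS Uf => n /= /negP/negbTE.
by move=> Uf'; have [n [/= h]] := @filter_ex _ _ _ _ (filterI Uf Uf').
Qed.

Lemma lim_of_limit_point (A : set bool_group) b f :
  independent f -> injective (fun n => vec (f n)) -> (forall n, A (vec (f n))) ->
  limit_point A (vec [:: lim_of b f]).
Proof.
move=> indf injf Af U [F _ FU].
have neq : ultra (lim_of b f) [set n | vec (f n) <> vec [:: lim_of b f]].
  have [[n En]|/forallNP N] := pselect (exists n, vec (f n) = vec [:: lim_of b f]).
    by apply: filterS (@ultra_neq (lim_of b f) n) => k /= neq; rewrite -En => /injf.
  by apply: filterE => n; exact: N.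
have [n [agr /eqP ne]] := @filter_ex _ _ _ _ (filterI (lim_of_agree F b indf) neq).
by exists (vec (f n)); split=> //; exact: FU.
Qed.

Lemma two_limit_points (A : set bool_group) : infinite_set A ->
  exists x y, [/\ x <> y, limit_point A x & limit_point A y].
Proof.
move=> /independent_sequence[f [indf injf Af]].
exists (vec [:: lim_of true f]), (vec [:: lim_of false f]).
by split; [move=> /vec1_inj|exact: lim_of_limit_point..].
Qed.

Theorem theorem4p1 :
  exists G : topologicalGroupType,
    [/\ infinite_set [set: G],
        hausdorff_space G,
        countably_compact G,
        boolean_group G
      & no_nontrivial_cvg_seq G].
Proof.
exists bool_group; split.
- exact: bool_group_infinite.
- exact: bool_group_hausdorff.
- by move=> A /two_limit_points[x [_ [_ xlim _]]]; exists x.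
- by [].
- exact/(two_limit_points_no_cvg_seq bool_group_hausdorff)/two_limit_points.
Qed.
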